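(* Let $n$ be a positive integer and let $(S_{n-1}, C_n, \triangleright, \triangleleft)$ be the canonical matched pair associated to the factorization $S_n = S_{n-1} C_n$. Then: (1) Any group of order $n$ is isomorphic to an $r$-deformation $(C_n)_r$ of the cyclic group $C_n$, for some deformation map $r : C_n \to S_{n-1}$ of the matched pair $(S_{n-1}, C_n, \triangleright, \triangleleft)$. The multiplication $\bullet$ on $(C_n)_r$ is given by $x \bullet y = (x \triangleleft r(y))\, y$ for all $x, y \in (C_n)_r$, where juxtaposition denotes the multiplication in the cyclic group $C_n$. (2) The number of isomorphism types of groups of order $n$ is equal to $$|\mathcal{D}(C_n, S_{n-1} \mid (\triangleright, \triangleleft))| .$$
   Context: Setting: $S_n$ is the symmetric group on $\{1, \dots, n\}$ with its usual Coxeter generators $s_1, \dots, s_{n-1}$, where $s_i = (i, i+1)$; $S_{n-1}$ is the subgroup of $S_n$ generated by $s_1, \dots, s_{n-2}$ (the stabilizer of the point $n$), and $C_n$ is the cyclic subgroup of order $n$ generated by $s_1 s_2 \cdots s_{n-1}$. Then $S_n = S_{n-1} C_n$ and $S_{n-1} \cap C_n = \{1\}$. Matched pair: a matched pair of groups is a quadruple $(A, H, \triangleright, \triangleleft)$ where $A$, $H$ are groups, $\triangleright : H \times A \to A$ is a left action of the group $H$ on the set $A$, and $\triangleleft : H \times A \to H$ is a right action of the group $A$ on the set $H$, such that for all $a, b \in A$ and $h, g \in H$: $$h \triangleright (ab) = (h \triangleright a)\,((h \triangleleft a) \triangleright b), \qquad (hg) \triangleleft a = (h \triangleleft (g \triangleright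 a))\,(g \triangleleft a).$$ Canonical matched pair: if $A, H \leq G$ are subgroups with $G = AH$ and $A \cap H = \{1\}$, then for all $a \in A$, $h \in H$ there is a unique pair $(h \triangleright a,\, h \triangleleft a) \in A \times H$ such that $h a = (h \triangleright a)(h \triangleleft a)$ in $G$; this defines a matched pair $(A, H, \triangleright, \triangleleft)$, called the canonical matched pair associated to the factorization $G = AH$. Deformation map: a deformation map of a matched pair $(A, H, \triangleright, \triangleleft)$ is a function $r : H \to A$ with $r(1) = 1$ and, for all $g, h \in H$, $r\bigl((h \triangleleft r(g))\, g\bigr) = r(h)\,(h \triangleright r(g))$. The $r$-deformation $H_r$ of $H$ is the group with underlying set $H$ and multiplication $h \bullet g := (h \triangleleft r(g))\, g$. Equivalence: two deformation maps $r, R : H \to A$ are equivalent, written $r \sim R$, if there exists a permutation $\sigma : H \to H$ of the set $H$ with $\sigma(1) = 1$ and $\sigma\bigl((h \triangleleft r(g))\, g\bigr) = \bigl(\sigma(h) \triangleleft R(\sigma(g))\bigr)\, \sigma(g)$ for all $g, h \in H$. This is an equivalence relation, and $\mathcal{D}(H, A \mid (\triangleright, \triangleleft))$ denotes the set of all deformation maps of $(A, H, \triangleright, \triangleleft)$ modulo $\sim$. *)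

(* Defs.v *)
From HB Require Import structures.
From mathcomp Require Import all_boot all_fingroup.
From mathcomp Require Import zify.

Set Implicit Arguments.
Unset Strict Implicit.
Unset Printing Implicit Defensive.

Local Open Scope group_scope.

Record matched_pair (A H : finGroupType) := MatchedPair {
  matched_lact : H -> A -> A;  (* h |> a *)
  matched_ract : H -> A -> H;  (* h <| a *)
  matched_lact1 : forall a, matched_lact 1 a = a;
  matched_lactM : forall h g a,
    matched_lact (h * g) a = matched_lact h (matched_lact g a);
  matched_ract1 : forall h, matched_ract h 1 = h;
  matched_ractM : forall h a b,
    matched_ract h (a * b) = matched_ract (matched_ract h a) b;
  matched_lact_mul : forall h a b,
    matched_lact h (a * b) = matched_lact h a * matched_lact (matched_ract h a) b;
  matched_ract_mul : forall h g a,
    matched_ract (h * g) a = matched_ract h (matched_lact g a) * matched_ract g a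
}.

Section MatchedPairTheory.
Variables (A H : finGroupType) (mp : matched_pair A H).

Lemma matched_lact_1 h : matched_lact mp h 1 = 1.
Proof.
have /eqP := matched_lact_mul mp h 1 1.
by rewrite matched_ract1 mulg1 eq_sym -{3}[matched_lact mp h 1]mulg1
  (inj_eq (mulgI _)) => /eqP.
Qed.

Lemma matched_ract_1 a : matched_ract mp 1 a = 1.
Proof.
have /eqP := matched_ract_mul mp 1 1 a.
by rewrite matched_lact1 mulg1 eq_sym -{3}[matched_ract mp 1 a]mulg1
  (inj_eq (mulgI _)) => /eqP.
Qed.

End MatchedPairTheory.

Section Canonical.
Variables (gT : finGroupType) (G A H : {group gT}).
Hypotheses (defG : A * H = G) (tiAH : A :&: H = 1).

Definition canonical_lact (h : subg_of H) (a : subg_of A) : subg_of A :=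
  subg A (divgr A H (sgval h * sgval a)).

Definition canonical_ract (h : subg_of H) (a : subg_of A) : subg_of H :=
  subg H (remgr A H (sgval h * sgval a)).

Lemma canonical_mem (h : subg_of H) (a : subg_of A) :
  sgval h * sgval a \in A * H.
Proof.
rewrite defG groupM //; apply: subsetP (subgP _); rewrite -defG.
  exact: mulG_subr.
exact: mulG_subl.
Qed.

Lemma canonicalE h a :
  sgval h * sgval a = sgval (canonical_lact h a) * sgval (canonical_ract h a).
Proof.
rewrite !subgK ?mem_divgr ?mem_remgr ?canonical_mem //.
exact: divgr_eq.
Qed.

Lemma canonical_uniq h a (a' : subg_of A) (h' : subg_of H) :
    sgval h * sgval a = sgval a' * sgval h' ->
  a' = canonical_lact h a /\ h' = canonical_ract h a.
Proof.
move=> eq_ha; rewrite /canonical_lact /canonical_ract eq_ha.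
by rewrite divgrMid ?remgrMid ?subgP // !sgvalK.
Qed.

Fact canonical_lact1 a : canonical_lact 1 a = a.
Proof. by have [] := @canonical_uniq 1 a a 1; rewrite ?mul1g ?mulg1. Qed.

Fact canonical_ract1 h : canonical_ract h 1 = h.
Proof. by have [] := @canonical_uniq h 1 1 h; rewrite ?mul1g ?mulg1. Qed.

Fact canonical_mulH h g a :
  canonical_lact (h * g) a = canonical_lact h (canonical_lact g a)
  /\ canonical_ract (h * g) a
     = canonical_ract h (canonical_lact g a) * canonical_ract g a.
Proof.
have [|-> ->] // := @canonical_uniq (h * g) a
  (canonical_lact h (canonical_lact g a))
  (canonical_ract h (canonical_lact g a) * canonical_ract g a).
by rewrite /= -mulgA canonicalE mulgA canonicalE mulgA.
Qed.

Fact canonical_mulA h a b :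
  canonical_lact h (a * b)
    = canonical_lact h a * canonical_lact (canonical_ract h a) b
  /\ canonical_ract h (a * b) = canonical_ract (canonical_ract h a) b.
Proof.
have [|-> ->] // := @canonical_uniq h (a * b)
  (canonical_lact h a * canonical_lact (canonical_ract h a) b)
  (canonical_ract (canonical_ract h a) b).
by rewrite /= mulgA canonicalE -mulgA canonicalE mulgA.
Qed.

Definition canonical_matched_pair : matched_pair (subg_of A) (subg_of H) :=
  MatchedPair canonical_lact1
    (fun h g a => (canonical_mulH h g a).1)
    canonical_ract1
    (fun h a b => (canonical_mulA h a b).2)
    (fun h a b => (canonical_mulA h a b).1)
    (fun h g a => (canonical_mulH h g a).2).

End Canonical.

Section Deformation.
Variables (A H : finGroupType) (mp : matched_pair A H).

Definition is_deformation_map (r : {ffun H -> A}) : bool :=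
  (r 1 == 1) &&
  [forall g, forall h,
     r (matched_ract mp h (r g) * g) == r h * matched_lact mp h (r g)].

Record deformation_map :=
  DeformationMap { dmap :> {ffun H -> A}; _ : is_deformation_map dmap }.

HB.instance Definition _ := [isSub for dmap].
HB.instance Definition _ := [Finite of deformation_map by <:].

Lemma dmap1 (r : deformation_map) : r 1 = 1.
Proof. by case: r => r /= /andP[/eqP]. Qed.

Lemma dmapM (r : deformation_map) h g :
  r (matched_ract mp h (r g) * g) = r h * matched_lact mp h (r g).
Proof. by case: r => r /= /andP[_ /forallP/(_ g)/forallP/(_ h)/eqP]. Qed.

(* [H_r], as an alias of [H]: elements of the two types are interchangeable. *)
Definition deformation (r : deformation_map) : Type := H.

Section Group.
Variable r : deformation_map.

Definition deformation_mul (h g : deformation r) : deformation r :=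
  matched_ract mp h (r g) * g.

Definition deformation_one : deformation r := (1 : H).

Definition deformation_inv (h : deformation r) : deformation r :=
  matched_ract mp (h : H)^-1 (r h)^-1.

Fact deformation_mulA : associative deformation_mul.
Proof.
move=> h g k; rewrite /deformation_mul dmapM matched_ract_mul matched_ractM.
by rewrite mulgA.
Qed.

Fact deformation_mul1 : left_id deformation_one deformation_mul.
Proof. by move=> h; rewrite /deformation_mul matched_ract_1 mul1g. Qed.

Fact deformation_mulV :
  left_inverse deformation_one deformation_inv deformation_mul.
Proof.
move=> h; rewrite /deformation_mul /deformation_inv -matched_ractM.
by rewrite mulVg matched_ract1 mulVg.
Qed.

HB.instance Definition _ := Finite.copy (deformation r) H.
HB.instance Definition _ := Finite_isGroup.Build (deformation r)
  deformation_mulA deformation_mul1 deformation_mulV.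

End Group.

Definition deformation_equiv (r R : deformation_map) : bool :=
  [exists sigma : {perm H}, (sigma 1 == 1) &&
    [forall g, forall h,
       sigma (matched_ract mp h (r g) * g)
         == matched_ract mp (sigma h) (R (sigma g)) * sigma g]].

Lemma deformation_equivP (r R : deformation_map) :
  reflect (exists sigma : {perm H}, sigma 1 = 1 /\
             forall g h, sigma (matched_ract mp h (r g) * g)
                         = matched_ract mp (sigma h) (R (sigma g)) * sigma g)
          (deformation_equiv r R).
Proof.
apply: (iffP existsP) => -[s].
  case/andP=> /eqP s1 /forallP sM; exists s; split=> // g h.
  by have /forallP/(_ h)/eqP := sM g.
case=> s1 sM; exists s; rewrite s1 eqxx /=.
by apply/forallP=> g; apply/forallP=> h; rewrite sM.
Qed.

Lemma deformation_equiv_rel :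
  {in [set: deformation_map] & &, equivalence_rel deformation_equiv}.
Proof.
have equiv_refl r : deformation_equiv r r.
  apply/deformation_equivP; exists 1; rewrite perm1; split=> // g h.
  by rewrite !perm1.
have equiv_trans r R T : deformation_equiv r R -> deformation_equiv R T ->
    deformation_equiv r T.
  case/deformation_equivP=> s [s1 sM] /deformation_equivP[t [t1 tM]].
  apply/deformation_equivP; exists (s * t); rewrite permM s1 t1.
  by split=> // g h; rewrite !permM sM tM.
have equiv_sym r R : deformation_equiv r R -> deformation_equiv R r.
  case/deformation_equivP=> s [s1 sM]; apply/deformation_equivP.
  exists s^-1; split=> [|g h]; first by rewrite -{1}s1 permK.
  by apply: (@perm_inj _ s); rewrite sM !permKV.
move=> r R T _ _ _; split=> // rR; apply/idP/idP; last exact: equiv_trans.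
exact/equiv_trans/equiv_sym.
Qed.

Definition deformation_classes : {set {set deformation_map}} :=
  equivalence_partition deformation_equiv [set: deformation_map].

End Deformation.

(* Isomorphism types of groups of order [n] form a set once the groups are
   taken on the fixed carrier ['I_n]; [group_structure_complete] shows that
   this loses no group. *)
Section GroupStructure.
Variable n : nat.

Definition is_group_structure
    (s : {ffun 'I_n * 'I_n -> 'I_n} * 'I_n * {ffun 'I_n -> 'I_n}) : bool :=
  let mul := s.1.1 in let one := s.1.2 in let inv := s.2 in
  [&& [forall x, forall y, forall z,
         mul (x, mul (y, z)) == mul (mul (x, y), z)],
      [forall x, mul (one, x) == x]
    & [forall x, mul (inv x, x) == one]].

Record group_structure := GroupStructure {
  group_ops :> {ffun 'I_n * 'I_n -> 'I_n} * 'I_n * {ffun 'I_n -> 'I_n};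
  _ : is_group_structure group_ops
}.

HB.instance Definition _ := [isSub for group_ops].
HB.instance Definition _ := [Finite of group_structure by <:].

Definition structured (s : group_structure) : Type := 'I_n.

Section Group.
Variable s : group_structure.

Definition structured_mul (x y : structured s) : structured s := s.1.1 (x, y).
Definition structured_one : structured s := s.1.2.
Definition structured_inv (x : structured s) : structured s := s.2 x.

Fact structured_mulA : associative structured_mul.
Proof.
move=> x y z; have /and3P[/forallP/(_ x)/forallP/(_ y)/forallP/(_ z)/eqP xyz _ _] :=
  valP s.
exact: xyz.
Qed.

Fact structured_mul1 : left_id structured_one structured_mul.
Proof.
by move=> x; have /and3P[_ /forallP/(_ x)/eqP] := valP s.
Qed.

Fact structured_mulV :
  left_inverse structured_one structured_inv structured_mul.
Proof.
by move=> x; have /and3P[_ _ /forallP/(_ x)/eqP] := valP s.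
Qed.

HB.instance Definition _ := Finite.copy (structured s) 'I_n.
HB.instance Definition _ := Finite_isGroup.Build (structured s)
  structured_mulA structured_mul1 structured_mulV.

End Group.

Definition structure_isog (s t : group_structure) : bool :=
  [set: structured s] \isog [set: structured t].

Lemma structure_isog_rel :
  {in [set: group_structure] & &, equivalence_rel structure_isog}.
Proof.
rewrite /structure_isog => s t u _ _ _; split=> [|isog_st]; first exact: isog_refl.
exact: (isog_transl _ isog_st).
Qed.

Definition iso_types : {set {set group_structure}} :=
  equivalence_partition structure_isog [set: group_structure].

Lemma group_structure_complete (gT : finGroupType) (G : {group gT}) :
  #|G| = n -> exists s : group_structure, G \isog [set: structured s].
Proof.
move=> oG.
have oS : #|subg_of G| = n by rewrite -oG -cardsT (card_isog (isog_subg G)).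
pose f (x : subg_of G) : 'I_n := cast_ord oS (enum_rank x).
pose f' (i : 'I_n) : subg_of G := enum_val (cast_ord (esym oS) i).
have fK : cancel f f' by move=> x; rewrite /f /f' cast_ordK enum_rankK.
have f'K : cancel f' f by move=> x; rewrite /f /f' enum_valK cast_ordKV.
pose mul : {ffun 'I_n * 'I_n -> 'I_n} := [ffun p => f (f' p.1 * f' p.2)].
pose inv : {ffun 'I_n -> 'I_n} := [ffun x => f (f' x)^-1].
have ok : is_group_structure (mul, f 1, inv).
  apply/and3P; split; apply/forallP=> x.
  - apply/forallP=> y; apply/forallP=> z.
    by rewrite !ffunE /= !fK mulgA.
  - by rewrite !ffunE /= !fK mul1g f'K.
  - by rewrite !ffunE /= !fK mulVg.
exists (GroupStructure ok); apply: isog_trans (isog_subg G) _.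
pose F (x : subg_of G) : structured (GroupStructure ok) := f x.
have FM : {in [set: subg_of G] &, {morph F : x y / x * y}}.
  by move=> x y _ _; rewrite /F [RHS]ffunE /= !fK.
apply/isogP; exists (Morphism FM).
  by apply/injmP=> x y _ _; apply: can_inj fK x y.
apply/setP=> y; rewrite inE; apply/imsetP; exists (f' y); first by rewrite !inE.
by rewrite /= /F f'K.
Qed.

End GroupStructure.

Fact coxeter_subproof n (i : 'I_n.-1) : i.+1 < n.
Proof. by case: n i => [[]|n i]; rewrite ?ltnS. Qed.

(* Points are numbered from [0], so [coxeter i] is the transposition
   [s_(i+1)] of the points [i+1] and [i+2] of [{1, .., n}]. *)
Definition coxeter n (i : 'I_n.-1) : 'S_n :=
  tperm (Ordinal (ltnW (coxeter_subproof i))) (Ordinal (coxeter_subproof i)).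

(* generated by [s_1, .., s_(n-2)] *)
Definition sym_pred n : {group 'S_n} :=
  <<[set coxeter i | i : 'I_n.-1 & i.+1 < n.-1]>>%G.

(* generated by [s_1 s_2 .. s_(n-1)].  Permutations are composed here
   from left to right.  Under the opposite convention inversion is an
   isomorphism of the two symmetric groups which fixes each [s_i], hence
   preserves this word and both subgroups. *)
Definition cyc n : {group 'S_n} :=
  <[\prod_(i < n.-1) coxeter i]>%G.

Section Factorization.
Variable m : nat.
Let n := m.+1.

Let t (i : nat) : 'S_n := tperm (inord i) (inord i.+1).

Let coxeterE (i : 'I_m) : @coxeter n i = t i.
Proof.
by congr tperm; apply: val_inj; rewrite /= inordK // ltnS // ltnW.
Qed.

Let stepE k (x : 'I_n) : k < m ->
  t k x = (if x == k :> nat then k.+1 else if x == k.+1 :> nat then k else x)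
    :> nat.
Proof.
move=> lt_km; rewrite /t permE /= -!val_eqE /= !inordK ?ltnS // 1?ltnW //.
by case: ifP => _; [|case: ifP => _ //]; rewrite inordK ?ltnS // ltnW.
Qed.

Let prodE k (x : 'I_n) : k <= m ->
  (\prod_(0 <= i < k) t i) x
    = (if x == 0 :> nat then k else if x <= k then x.-1 else x) :> nat.
Proof.
elim: k => [|k IHk] lt_km.
  by rewrite big_geq // perm1; case: (nat_of_ord x).
rewrite big_nat_recr //= permM stepE // IHk ?(ltnW lt_km) //.
case: (nat_of_ord x) => [|y] /=; first by rewrite eqxx.
by do !case: ifP; lia.
Qed.

Let c : 'S_n := \prod_(i < n.-1) coxeter i.

Let cE (x : 'I_n) : c x = (x + m) %% n :> nat.
Proof.
have -> : c = \prod_(0 <= i < m) t i.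
  by rewrite big_mkord; apply: eq_bigr => i _; rewrite coxeterE.
rewrite prodE //; case: x => -[|y] /= lt_yn; first by rewrite modn_small.
by rewrite -ltnS lt_yn addSnnS modnDr modn_small // ltnW.
Qed.

Let cXE k (x : 'I_n) : (c ^+ k) x = (x + k * m) %% n :> nat.
Proof.
elim: k => [|k IHk]; first by rewrite perm1 addn0 modn_small.
by rewrite expgSr permM cE IHk modnDml -addnA (addnC (k * m)%N) mulSn.
Qed.

Let G k := <<[set @coxeter n i | i : 'I_m & i.+1 < k]>>.

Let tG i k : i < m -> i.+1 < k -> t i \in G k.
Proof.
move=> lt_im lt_ik; apply: mem_gen; apply/imsetP.
by exists (Ordinal lt_im); rewrite ?inE ?coxeterE.
Qed.

Let tpermG d i k : i + d < n -> i + d < k ->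
  tperm (inord i) (inord (i + d)) \in G k.
Proof.
elim: d => [|d IHd] ltn ltk; first by rewrite addn0 tperm1 group1.
have [->|d_gt0] := posnP d; first by rewrite addn1; apply: tG; lia.
have -> : tperm (inord i) (inord (i + d.+1))
          = tperm (inord i) (inord (i + d)) ^ t (i + d) :> 'S_n.
  rewrite tpermJ /t tpermL tpermD ?addnS // -val_eqE /= !inordK; lia.
by rewrite groupJ ?tG ?IHd //; lia.
Qed.

Let fixG k (p : 'S_n) : k <= n -> (forall x : 'I_n, k <= x -> p x = x) ->
  p \in G k.
Proof.
elim: k p => [|k IHk] p le_kn pfix.
  by suff -> : p = 1; [exact: group1 | apply/permP=> x; rewrite perm1 pfix].
pose z : 'I_n := inord k; have zE : z = k :> nat by rewrite inordK.
have le_pz : p z <= k.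
  rewrite leqNgt; apply/negP=> lt_k.
  by have /perm_inj pz := pfix _ lt_k; rewrite pz zE ltnn in lt_k.
have tG' : tperm (p z) z \in G k.+1.
  have := @tpermG (k - p z) (p z) k.+1; rewrite subnKC // inord_val.
  exact.
rewrite -(mulgK (tperm (p z) z) p) groupMr ?groupV //.
have sG : G k \subset G k.+1.
  apply/genS/imsetS/subsetP=> i; rewrite !inE => lt_ik.
  exact: leqW.
apply: (subsetP sG); apply: IHk => [|x]; first exact: ltnW.
rewrite permM leq_eqVlt => /predU1P[kx|lt_kx].
  have -> : x = z by apply: val_inj; rewrite /= zE.
  exact: tpermL.
by rewrite (pfix x) // tpermD // -val_eqE /=; lia.
Qed.

Let z : 'I_n := ord_max.

Let sym_predP (p : 'S_n) : reflect (p z = z) (p \in sym_pred n).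
Proof.
apply: (iffP idP) => [pG|pz]; last first.
  apply: (@fixG m) => // x le_mx.
  suff -> : x = z by [].
  by apply: val_inj => /=; have := ltn_ord x; lia.
suff /subsetP/(_ p pG) : sym_pred n \subset 'C[z | 'P].
  by move=> /astab1P.
rewrite gen_subG; apply/subsetP=> q /imsetP[i + ->]; rewrite inE /= => lt_im.
apply/astab1P; rewrite /= /aperm coxeterE; apply: val_inj.
rewrite /= stepE ?(ltnW lt_im) //= gtn_eqF ?(ltnW lt_im) //.
by rewrite gtn_eqF.
Qed.

Let sym_pred_mul_cyc_S : sym_pred n * cyc n = [set: 'S_n].
Proof.
apply/setP=> p; rewrite [RHS]inE; set k := m - p z.
have ck : c ^+ k \in cyc n by apply: mem_cycle.
apply/mulsgP; exists (p * (c ^+ k)^-1) (c ^+ k) => //; last by rewrite mulgKV.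
apply/sym_predP; rewrite permM; apply: (canLR (permK _)); apply: val_inj.
have le_pz : p z <= m by rewrite -ltnS ltn_ord.
rewrite /= cXE /= -[X in (X + _) %% _](subnK le_pz) -/k.
by rewrite addnAC -mulnS modnMDl modn_small.
Qed.

Let sym_pred_cyc_TI_S : sym_pred n :&: cyc n = 1.
Proof.
apply/trivgP/subsetP=> p /setIP[/sym_predP + /cycleP[k pk]].
rewrite {p}pk -/c => /(congr1 val); rewrite /= cXE /= => eq_z.
rewrite inE; apply/eqP/permP=> x; rewrite perm1; apply: val_inj.
rewrite /= cXE -[RHS](@modn_small _ n) //; apply/eqP.
have: m + k * m == m + 0 %[mod n] by rewrite eq_z addn0 modn_small.
by rewrite eqn_modDl -{2}[nat_of_ord x]addn0 eqn_modDl.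
Qed.

Definition factorization_S := (sym_pred_mul_cyc_S, sym_pred_cyc_TI_S).

End Factorization.

Lemma sym_pred_mul_cyc n : sym_pred n * cyc n = [set: 'S_n].
Proof.
case: n => [|m]; last exact: (factorization_S m).1.
have S0 (p : 'S_0) : p = 1 by apply/permP=> -[].
by apply/setP=> p; rewrite inE (S0 p) -[1]mulg1 mem_mulg.
Qed.

Lemma sym_pred_cyc_TI n : sym_pred n :&: cyc n = 1.
Proof.
case: n => [|m]; last exact: (factorization_S m).2.
by apply/trivgP/subsetP=> p _; rewrite inE; apply/eqP/permP=> -[].
Qed.

Definition sym_cyc_matched_pair n :
    matched_pair (subg_of (sym_pred n)) (subg_of (cyc n)) :=
  @canonical_matched_pair _ [set: 'S_n]%G _ _
    (sym_pred_mul_cyc n) (sym_pred_cyc_TI n).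

(* Main.v *)
Require Import Defs.
From mathcomp Require Import all_boot all_fingroup.

(** Write [A] for the stabilizer of the last point in the symmetric group and
    [C] for the cyclic subgroup.  A group of order [n] acts regularly on itself,
    and after numbering its elements its regular representation is a subgroup
    [B] of ['S_n] of order [n] in which only the identity has a fixed point.
    So [B] meets [A] trivially, and since [#|A| * #|C| = n`!] with [#|C| = n],
    counting shows that [B] is a second complement of [A]
    ([sym_pred_complement]).

    Complements are what deformation maps describe
    ([deformation_of_complement]).  Each coset [A h] with [h \in C] contains
    exactly one element of [B]; write it [r h * h].  Multiplying two of these,
    [r h * h * (r g * g) = r h * (h |> r g) * ((h <| r g) * g)]
    is again in [B], and lies in the coset of [(h <| r g) * g].  Comparing the
    [A]-parts gives the deformation equation for [r], and shows that
    [h |-> r h * h] is an isomorphism from the [r]-deformation onto [B].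
    So every group of order [n] is such a deformation.

    For the count, equivalence of deformation maps is isomorphism of the deformed
    groups ([deformation_equiv_isog]).  So sending [r] to a group law on ['I_n]
    isomorphic to its deformation reflects and preserves equivalence, and by
    the first part it reaches every isomorphism type ([card_equivalence_partition]). *)

Local Open Scope group_scope.

(** * Counting classes *)

(** Taking preimages under [F] is a bijection from the [eS]-classes to the
    [eT]-classes: every [eS]-class is the class of some [F t], whose preimage
    is the class of [t]. *)
Lemma card_equivalence_partition (S T : finType) (eS : rel S) (eT : rel T)
    (F : T -> S) :
    {in [set: S] & &, equivalence_rel eS} ->
    (forall t u, eT t u = eS (F t) (F u)) ->
    (forall s, exists t, eS (F t) s) ->
  #|equivalence_partition eS [set: S]| = #|equivalence_partition eT [set: T]|.
Proof.
move=> eqS eTE surF.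
have eS_refl s : eS s s by have [] := eqS s s s (in_setT _) (in_setT _) (in_setT _).
have eS_class s t : eS s t -> eS s =1 eS t.
  move=> st u; have [_] := eqS s t u (in_setT _) (in_setT _) (in_setT _).
  exact.
have classS Y : Y \in equivalence_partition eS [set: S] ->
    exists t, Y = [set s | eS (F t) s].
  case/imsetP=> s _ ->; have [t ts] := surF s; exists t.
  by apply/setP=> u; rewrite !inE -(eS_class _ _ ts).
have preimF t : F @^-1: [set s | eS (F t) s] = [set u | eT t u].
  by apply/setP=> u; rewrite !inE eTE.
rewrite -(@card_in_imset _ _ (fun Y : {set S} => F @^-1: Y)).
  congr #|pred_of_set _|; apply/setP=> X; apply/imsetP/imsetP.
    case=> Y /classS[t ->] ->; exists t => //.
    by rewrite preimF; apply/setP=> u; rewrite !inE.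
  case=> t _ ->; exists [set s | eS (F t) s].
    by apply/imsetP; exists (F t) => //; apply/setP=> s; rewrite !inE.
  by rewrite preimF; apply/setP=> u; rewrite !inE.
move=> _ _ /classS[t ->] /classS[u ->].
rewrite !preimF => /setP/(_ u); rewrite !inE !eTE eS_refl => tu.
by apply/setP=> s; rewrite !inE (eS_class _ _ tu).
Qed.

(** * Deformation maps, isomorphisms and complements *)

(** The condition on [sigma] in the definition of equivalence says that [sigma]
    is an isomorphism for the two deformed group laws, which share the carrier
    [H] and the unit. *)
Lemma deformation_equiv_isog (A H : finGroupType) (mp : matched_pair A H)
    (r R : deformation_map mp) :
  deformation_equiv r R = ([set: deformation r] \isog [set: deformation R]).
Proof.
apply/deformation_equivP/isogP=> [[s [s1 sM]] | [f injf imf]].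
  pose f (x : deformation r) : deformation R := s x.
  have fM : {in [set: deformation r] &, {morph f : x y / x * y}}.
    by move=> x y _ _; apply: sM.
  exists (Morphism fM); first by apply/injmP=> x y _ _ /perm_inj.
  apply/setP=> y; rewrite inE; apply/imsetP; exists (s^-1 y); rewrite ?inE //.
  by rewrite /= /f permKV.
have f_inj : injective (f : H -> H).
  by move=> x y; apply: (injmP injf); rewrite inE.
exists (perm f_inj); split=> [|g h]; first by rewrite permE; apply: (morph1 f).
by rewrite !permE; apply: (morphM f); rewrite inE.
Qed.

(** The isomorphism sends [h] to the element [r h * h] of [B] in the coset
    [A h].  Since [A :&: B = 1], the factor [r h] is the only element
    of [A] bringing [h] into [B]; this uniqueness gives the deformation
    equation and surjectivity, while [A :&: H = 1] gives injectivity. *)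
Lemma deformation_of_complement (gT : finGroupType) (G A H B : {group gT})
    (defG : A * H = G) (tiAH : A :&: H = 1) :
    A * B = G -> A :&: B = 1 ->
  exists r : deformation_map (canonical_matched_pair defG tiAH),
    B \isog [set: deformation r].
Proof.
move=> defB tiAB.
(* Factoring [h = a * b] along [A * B = G], the element of [B] in [A h] is
   [b = a^-1 * h]. *)
pose r : {ffun subg_of H -> subg_of A} :=
  [ffun h => subg A (divgr A B (sgval h))^-1].
have HinAB (h : subg_of H) : sgval h \in A * B.
  by rewrite defB -defG (subsetP (mulG_subr _ _)) ?subgP.
have rE (h : subg_of H) : sgval (r h) * sgval h = remgr A B (sgval h).
  by rewrite ffunE subgK ?groupV ?mem_divgr // invMg invgK mulgKV.
have rB (h : subg_of H) : sgval (r h) * sgval h \in B by rewrite rE mem_remgr.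
have r_uniq h (a : subg_of A) : sgval a * sgval h \in B -> a = r h.
  move=> ahB; apply/eqP; rewrite -(inj_eq val_inj) /= eq_mulgV1 -in_set1.
  rewrite -[[set 1]]/(1 : {set gT}) -tiAB inE groupM ?groupV ?subgP //=.
  have -> : sgval a * (sgval (r h))^-1
    = (sgval a * sgval h) * (sgval (r h) * sgval h)^-1.
    by rewrite invMg mulgA mulgK.
  by rewrite groupM ?groupV.
have prodE (h g : subg_of H) : sgval (r h) * sgval (canonical_lact h (r g))
    * (sgval (canonical_ract h (r g)) * sgval g)
    = (sgval (r h) * sgval h) * (sgval (r g) * sgval g).
  rewrite -!mulgA; congr (_ * _); rewrite !mulgA; congr (_ * _).
  by rewrite (canonicalE defG).
have r_ok : is_deformation_map (canonical_matched_pair defG tiAH) r.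
  apply/andP; split; first by rewrite eq_sym; apply/eqP/r_uniq; rewrite /= mulg1.
  apply/forallP=> g; apply/forallP=> h; rewrite eq_sym; apply/eqP/r_uniq.
  by rewrite /= prodE groupM.
exists (DeformationMap r_ok); rewrite isog_sym.
pose f (h : deformation (DeformationMap r_ok)) : gT :=
  sgval (r h) * sgval (h : subg_of H).
have fM : {in [set: deformation (DeformationMap r_ok)] &,
            {morph f : x y / x * y}}.
  move=> h g _ _; rewrite /f -prodE.
  pose hg : subg_of H := canonical_ract h (r g) * g.
  rewrite -[RHS](congr1 (fun a : subg_of A => sgval a * sgval hg)
    (dmapM (DeformationMap r_ok) h g)).
  by [].
apply/isogP; exists (Morphism fM).
  apply/injmP=> h g _ _ /= /(congr1 (remgr A H)).
  by rewrite /f !remgrMid ?subgP //; apply: val_inj.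
apply/setP=> b; apply/idP/idP=> [/morphimP[h _ _ ->]|bB]; first exact: rB.
have bAH : b \in A * H by rewrite defG -defB (subsetP (mulG_subr _ _)).
pose h := subg H (remgr A H b); have bE := divgr_eq A H b.
have bA : sgval (subg A (divgr A H b)) = divgr A H b by rewrite subgK ?mem_divgr.
have bH : sgval h = remgr A H b by rewrite subgK ?mem_remgr.
apply/morphimP; exists h; rewrite ?inE //= /f -(r_uniq h (subg A (divgr A H b))).
  by rewrite bA bH.
by rewrite bA bH -bE.
Qed.

(** * Complements of a point stabilizer *)

Lemma sym_pred_fix m (p : 'S_m.+1) : p \in sym_pred m.+1 -> p ord_max = ord_max.
Proof.
suff /subsetP sub : sym_pred m.+1 \subset 'C[ord_max | 'P].
  by move/sub/astab1P.
rewrite gen_subG; apply/subsetP=> q /imsetP[i + ->]; rewrite inE /= => lt_im.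
apply/astab1P; rewrite /= /aperm tpermD // -val_eqE /= neq_ltn ?lt_im //.
by rewrite (ltnW lt_im).
Qed.

(** The factor [sym_pred] fixes the last point, so the transitivity of ['S_n] is
    inherited by the factor [cyc]; being abelian, [cyc] is then regular. *)
Lemma card_cyc m : #|cyc m.+1| = m.+1.
Proof.
have trC : orbit 'P (cyc m.+1) ord_max = [set: 'I_m.+1].
  apply/setP=> x; rewrite inE; apply/orbitP.
  have : tperm ord_max x \in sym_pred m.+1 * cyc m.+1.
    by rewrite sym_pred_mul_cyc inE.
  case/mulsgP=> a c /sym_pred_fix fix_a cC /(congr1 (fun p : 'S__ => p ord_max)).
  by rewrite tpermL permM fix_a => ->; exists c.
rewrite -(card_orbit_stab 'P (cyc m.+1) ord_max) trC cardsT card_ord.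
suff -> : 'C_(cyc m.+1)[ord_max | 'P] = 1 by rewrite cards1 muln1.
apply/trivgP/subsetP=> c /setIP[cC /astab1P fix_c]; rewrite inE.
apply/eqP/permP=> x; rewrite perm1.
have : x \in orbit 'P (cyc m.+1) ord_max by rewrite trC inE.
case/orbitP=> d dC <-; rewrite /= /aperm -permM.
(* If [c] fixes one point and commutes with [d], it also fixes the
   image of that point under [d]. *)
have abC : abelian (cyc m.+1) by apply: cycle_abelian.
rewrite (centsP abC d dC c cC) permM; congr (d _); exact: fix_c.
Qed.

Lemma sym_pred_complement m (B : {group 'S_m.+1}) :
    #|B| = m.+1 -> (forall p, p \in B -> p ord_max = ord_max -> p = 1) ->
  sym_pred m.+1 * B = [set: 'S_m.+1] /\ sym_pred m.+1 :&: B = 1.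
Proof.
move=> oB semiregB.
have tiB : sym_pred m.+1 :&: B = 1.
  apply/trivgP/subsetP=> p /setIP[/sym_pred_fix fix_p pB].
  by rewrite inE (semiregB p).
have oS : (#|sym_pred m.+1| * m.+1)%N = #|[set: 'S_m.+1]|.
  by have := TI_cardMg (sym_pred_cyc_TI m.+1); rewrite sym_pred_mul_cyc card_cyc.
by split=> //; apply/eqP; rewrite eqEcard subsetT /= TI_cardMg // oB oS.
Qed.

(** The regular representation acts by right translation, which is a morphism
    because permutations compose from left to right. *)
Lemma regular_rep n (s : group_structure n) :
  exists2 B : {group 'S_n}, [set: structured s] \isog B
    & forall (p : 'S_n) x, p \in B -> p x = x -> p = 1.
Proof.
pose f (x : structured s) : 'S_n := perm (mulIg x : injective (_ : 'I_n -> 'I_n)).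
have fE x (y : structured s) : f x y = (y * x : structured s) by rewrite permE.
have fM : {in [set: structured s] &, {morph f : x y / x * y}}.
  by move=> x y _ _; apply/permP=> z; rewrite permM !fE mulgA.
exists (Morphism fM @* [set: structured s])%G => [|p x /morphimP[y _ _ ->] /=].
  apply: (sub_isog (subxx _)); apply/injmP=> x y _ _ /= /permP/(_ s.1.2).
  by rewrite !fE !mul1g.
rewrite fE => fix_x; have -> : y = 1.
  by apply: (@mulgI _ (x : structured s)); rewrite mulg1.
by apply/permP=> z; rewrite fE mulg1 perm1.
Qed.

Lemma sym_cyc_deformation n (gT : finGroupType) (G : {group gT}) :
    0 < n -> #|G| = n ->
  exists r : deformation_map (sym_cyc_matched_pair n),
    G \isog [set: deformation r].
Proof.
case: n => // m _ oG; have [s Gs] := group_structure_complete oG.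
have [B sB regB] := regular_rep _ s.
have [|//|defB tiB] := sym_pred_complement _ B.
- by rewrite -(card_isog sB) -(card_isog Gs).
- by move=> p pB; exact: regB.
have [r Br] := deformation_of_complement _ _ _ _ _ (sym_pred_mul_cyc _)
  (sym_pred_cyc_TI _) defB tiB.
by exists r; apply: isog_trans Gs (isog_trans sB Br).
Qed.

Theorem corollary3p2 (n : nat) (n_gt0 : (0 < n)%N) :
  (forall (gT : finGroupType) (G : {group gT}), #|G| = n ->
     exists r : deformation_map (sym_cyc_matched_pair n),
       G \isog [set: deformation r]
       /\ forall x y : subg_of (cyc n),
            ((x : deformation r) * (y : deformation r) : deformation r)
            = (matched_ract (sym_cyc_matched_pair n) x (r y) * y : subg_of (cyc n)))
  /\ #|iso_types n| = #|deformation_classes (sym_cyc_matched_pair n)|.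
Proof.
split=> [gT G oG|].
  by have [r Gr] := sym_cyc_deformation _ _ _ n_gt0 oG; exists r.
have oD (r : deformation_map (sym_cyc_matched_pair n)) :
    #|[set: deformation r]| = n.
  rewrite cardsT; have -> : #|{: deformation r}| = #|subg_of (cyc n)| by [].
  rewrite -cardsT -(card_isog (isog_subg _)).
  by case: n n_gt0 {r} => // m _; rewrite card_cyc.
have /fin_all_exists[F FP] (r : deformation_map (sym_cyc_matched_pair n)) :
    exists s : group_structure n, [set: deformation r] \isog [set: structured s].
  by have [s rs] := group_structure_complete (oD r); exists s.
apply: (@card_equivalence_partition _ _ _ _ F).
- exact: structure_isog_rel.
- move=> r R; rewrite deformation_equiv_isog /structure_isog.
  by rewrite (isog_transl _ (FP r)) (isog_transr _ (FP R)).
- move=> s; have [|r sr] := @sym_cyc_deformation n _ [set: structured s]%G n_gt0.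
    by rewrite cardsT card_ord.
  by exists r; rewrite /structure_isog isog_sym; apply: isog_trans sr (FP r).
Qed.
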